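(* There exists a binary sequence $S$ such that $R_{\mathrm{PPM}^*}(S)=0$ but for every $k\in\mathbb{N}$, $\rho_{\mathrm{PPM}_k}(S)\ge \tfrac12$. Here $R_T(S)=\limsup_{m\to\infty}|T(S\upharpoonright m)|/m$ and $\rho_T(S)=\liminf_{m\to\infty}|T(S\upharpoonright m)|/m$.
   Context: $S\upharpoonright m$ is the length-$m$ prefix of $S$; $\log$ is base $2$. Common model mechanics (without exclusion, escape Method C) on binary input: after reading a prefix $x$, each stored context $c$ has, for each bit $b$, a frequency count equal to the number of occurrences of $cb$ as a substring of $x$, and an escape count equal to the number of distinct bits that have followed $c$ in $x$; a context is deterministic if its escape count is $1$. Relevant contexts are the stored contexts that are suffixes of $x$. To encode the next bit $b$ starting from a chosen current context: if $b$ has count $f>0$ there, it is encoded with probability $f/(T+e)$ ($T$ the total bit count, $e$ the escape count); otherwise an escape is encoded with probability $e/(T+e)$ and the next shorter relevant context becomes current; if $b$ is unseen even in the empty context, after the escape $b$ is encoded with probability $1/2$. The model is then updated. The output is an arithmetic code of length $\lceil -\log P\rceil+O(1)$, $P$ the product of all probabilities used. $\mathrm{PPM}^*$: the stored contexts are the empty context and, whenever a string $w$ occurs at least twice in $x$, the contexts $wb$ for each bit $b$ such that $wb$ occurs in $x$ followed by a further bit; the initial current context is the shortest deterministic relevant context, or the longest relevant context if none is deterministic. $\mathrm{PPM}_k$ (bounded PPM with maximal context length $k$): the stored contexts are all strings of length at most $k$ that have occurred in $x$ followed by a bit (plus the empty context); the initial current context is the longest relevant context. *)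

(* Defs.v *)
From Stdlib Require Import Reals.
From Coquelicot Require Import Coquelicot.
From mathcomp Require Import ssreflect ssrfun ssrbool eqtype ssrnat seq.

Set Implicit Arguments.
Unset Strict Implicit.

Definition occ (w x : seq bool) : nat :=
  count (fun i => take (size w) (drop i x) == w) (iota 0 (size x - size w).+1).

Definition freq (x c : seq bool) (b : bool) : nat := occ (rcons c b) x.

Definition tot (x c : seq bool) : nat := (freq x c false + freq x c true)%N.

Definition esc (x c : seq bool) : nat :=
  ((0 < freq x c false) + (0 < freq x c true))%N.

Definition deterministic (x c : seq bool) : bool := esc x c == 1%N.

Definition occ_followed (x c : seq bool) : bool := (0 < tot x c)%N.

(* ---------- generic PPM model (no exclusion, escape method C) ---------- *)

(* A PPM variant is given by its set of stored contexts (depending on the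
   prefix x read so far) and by the choice of initial current context,
   given as an index into the list of relevant contexts sorted by
   decreasing length. *)
Record ppm_model := PPMModel {
  stored : seq bool -> seq bool -> bool;
  start  : seq bool -> seq (seq bool) -> nat }.

Definition relevant (M : ppm_model) (x : seq bool) : seq (seq bool) :=
  [seq drop i x | i <- iota 0 (size x).+1 & stored M x (drop i x)].

Open Scope R_scope.

(* probability of encoding bit b, starting from the first context of l and
   escaping down the list l (decreasing length); after escaping from the
   last (empty) context the bit is coded with probability 1/2.
   Convention: escaping from a context with no counts at all (T + e = 0,
   possible only for the empty context at the very start) costs nothing. *)
Fixpoint chainP (x : seq bool) (b : bool) (l : seq (seq bool)) : R :=
  match l with
  | [::] => / 2
  | c :: l' =>
      let f := freq x c b in
      let T := tot x c in
      let e := esc x c in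
      if (0 < f)%N then INR f / INR (T + e)
      else (if (T + e == 0)%N then 1 else INR e / INR (T + e)) * chainP x b l'
  end.

Definition stepP (M : ppm_model) (x : seq bool) (b : bool) : R :=
  let rel := relevant M x in chainP x b (drop (start M x rel) rel).

Definition probP (M : ppm_model) (x : seq bool) : R :=
  foldr Rmult 1 [seq stepP M (take i x) (nth false x i) | i <- iota 0 (size x)].

Definition Rceil (r : R) : R := IZR (- Int_part (- r)).

(* output length |T(x)| = ceil(-log2 P(x))  (the additive O(1) is taken to be 0) *)
Definition codelen (M : ppm_model) (x : seq bool) : R :=
  Rceil (- (ln (probP M x) / ln 2)).

Definition ratio (M : ppm_model) (S : nat -> bool) (m : nat) : R :=
  codelen M (mkseq S m) / INR m.

Definition Rsup (M : ppm_model) (S : nat -> bool) : Rbar := LimSup_seq (ratio M S).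
Definition rhoinf (M : ppm_model) (S : nat -> bool) : Rbar := LimInf_seq (ratio M S).

Close Scope R_scope.

Definition star_stored (x c : seq bool) : bool :=
  (c == [::]) ||
  ((1 < occ (take (size c).-1 c) x)%N && occ_followed x c).

(* index of the shortest deterministic relevant context, or 0 (the longest
   relevant context) if none is deterministic *)
Definition star_start (x : seq bool) (rel : seq (seq bool)) : nat :=
  let j := find (deterministic x) (rev rel) in
  if (j < size rel)%N then (size rel - j.+1)%N else 0%N.

Definition PPMstar : ppm_model := PPMModel star_stored star_start.

Definition k_stored (k : nat) (x c : seq bool) : bool :=
  (c == [::]) || ((size c <= k)%N && occ_followed x c).

Definition PPMk (k : nat) : ppm_model := PPMModel (k_stored k) (fun _ _ => 0%N).

(* Main.v *)
(* The sequence is cut into phases.  In phase [j], which starts at position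
   [per j ^ 8] (0 if [j = 0]), it follows a periodic sequence whose period, of length
   [per j], is the concatenation of all words of length [2 ^ j].

   PPM_k: each fixed word [w] has density [2 ^ - size w] up to a factor that
   tends to 1 in late phases, since only occurrences straddling two blocks are
   uncontrolled.  Hence both bits are eventually almost equally frequent after
   every context of length [k], and every step costs at least half a bit.

   PPM*: in phase [j] the last [3 * per j] bits form a stored deterministic
   context as soon as [4 * per j] bits of the phase have been read.  So the
   shortest deterministic context predicts the next bit correctly, and its count
   exceeds [per j] after [O(per j ^ 2)] bits; each later step of the phase costs
   at most [1 / per j], while the [O(per j ^ 2)] earlier ones cost
   [O(log m)] each, which is negligible against [m >= per j ^ 8]. *)

From mathcomp Require Import all_boot zify.
From Stdlib Require Import Reals Lra.
From Coquelicot Require Import Coquelicot.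
(* [Reals] and Coquelicot shadow [_ ^ _] on [nat] and [iota]. *)
From mathcomp Require Import ssrnat seq.
Require Import Defs.

Set Implicit Arguments.
Unset Strict Implicit.

(** * The sequence *)


Definition per j := 2 ^ j * 2 ^ (2 ^ j).

Definition start j := (0 < j) * per j ^ 8.

Lemma per_gtn j : j < per j.
Proof.
rewrite /per; apply: leq_trans (ltn_expl j (isT : 1 < 2)) _.
by rewrite leq_pmulr // expn_gt0.
Qed.

Lemma per_gt0 j : 0 < per j. Proof. exact: leq_ltn_trans (per_gtn j). Qed.

Lemma per_gt1 j : 1 < per j.
Proof.
case: j => [|j]; first by [].
by apply: leq_ltn_trans (per_gtn _).
Qed.

(** All periods are powers of two with increasing exponents. The factor [2] lets [per i] divide half
    of [per j], which [next_bit] exploits. *)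
Lemma per_dvd i j : i < j -> per i * 2 %| per j.
Proof.
move=> ltij; rewrite /per -!expnD -expnSr dvdn_exp2l //.
by rewrite -addSn leq_add // leq_exp2l // ltnW.
Qed.

Lemma per_dvdW i j : i <= j -> per i %| per j.
Proof.
rewrite leq_eqVlt => /predU1P[->|/per_dvd]; first exact: dvdnn.
by apply: dvdn_trans; apply: dvdn_mulr.
Qed.

Lemma perS j : 2 * per j <= per j.+1.
Proof. by rewrite mulnC dvdn_leq ?per_gt0 // per_dvd. Qed.

Lemma startS2 j : 2 * start j <= start j.+1.
Proof.
rewrite /start /= mul1n; case: j => [|j]; first by rewrite mul0n muln0.
rewrite mul1n; apply: (@leq_trans ((2 * per j.+1) ^ 8)); last by rewrite leq_exp2r ?perS.
by rewrite expnMn leq_mul2r orbT.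
Qed.

Lemma startSE j : start j.+1 = per j.+1 ^ 8.
Proof. by rewrite /start mul1n. Qed.

Lemma start_gt0 j : 0 < start j.+1.
Proof. by rewrite startSE expn_gt0 per_gt0. Qed.

Lemma startS j : start j < start j.+1.
Proof. have := startS2 j; have := start_gt0 j; case: j => [|j]; [by [] | lia]. Qed.

Lemma start_mono i j : i <= j -> start i <= start j.
Proof.
move=> /subnKC <-; elim: (j - i) => [|d IH]; first by rewrite addn0.
by rewrite addnS (leq_trans IH) // ltnW ?startS.
Qed.

(** * Phases of positions *)

Fixpoint phase m :=
  if m is m'.+1 then
    if start (phase m').+1 <= m then (phase m').+1 else phase m'
  else 0.

Lemma phaseP m : start (phase m) <= m < start (phase m).+1.
Proof.
elim: m => [|m /andP[IH1 IH2]]; first by rewrite start_gt0.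
rewrite [phase _]/=; case: (leqP (start (phase m).+1) m.+1) => [le|lt]; last by rewrite lt andbT ltnW.
by rewrite le /= (leq_ltn_trans IH2) ?startS.
Qed.

Lemma phase_start m : start (phase m) <= m. Proof. by case/andP: (phaseP m). Qed.

Lemma phase_lt m : m < start (phase m).+1. Proof. by case/andP: (phaseP m). Qed.

Lemma phase_ge j m : start j <= m -> j <= phase m.
Proof.
move=> le; rewrite leqNgt; apply/negP => /start_mono le'.
by have := leq_trans (phase_lt m) (leq_trans le' le); rewrite ltnn.
Qed.

Lemma phase_le j m : m < start j.+1 -> phase m <= j.
Proof.
move=> lt; rewrite leqNgt; apply/negP => /start_mono le.
by have := leq_trans lt (leq_trans le (phase_start m)); rewrite ltnn.
Qed.

Lemma phase_eq j m : start j <= m < start j.+1 -> phase m = j.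
Proof. by case/andP=> /phase_ge ? /phase_le ?; apply/eqP; rewrite eqn_leq; apply/andP. Qed.

(* The concatenation of all words of length [2 ^ j], cyclically repeated; the
   [v]-th word lists the binary digits of [v], least significant first. *)
Definition champ j i := odd (i %/ 2 ^ j %/ 2 ^ (i %% 2 ^ j)).

Definition sq i := champ (phase i) i.

Lemma odd_divDexp a b t : t < b -> odd ((a + 2 ^ b) %/ 2 ^ t) = odd (a %/ 2 ^ t).
Proof.
move=> tb; rewrite divnDr ?dvdn_exp2l 1?ltnW // -expnB // 1?ltnW //.
by rewrite oddD oddX subn_eq0 leqNgt tb addbF.
Qed.

(** The shift adds [2 ^ (2 ^ j)] to the word index and keeps the offset, while only digits below
    position [2 ^ j] are read. *)
Lemma champ_per j i : champ j (i + per j) = champ j i.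
Proof.
rewrite /champ /per [2 ^ j * _]mulnC addnC modnMDl divnMDl ?expn_gt0 //.
by rewrite addnC odd_divDexp // ltn_mod expn_gt0.
Qed.

Lemma champ_perM j i d : per j %| d -> champ j (i + d) = champ j i.
Proof.
case/dvdnP=> q ->; elim: q => [|q IH]; first by rewrite addn0.
by rewrite mulSn [per j + _]addnC addnA champ_per.
Qed.

(** [u] is the last position of word [v] and carries its top digit; half a period adds to the index
    exactly the power of two that flips this digit. *)
Lemma champ_half j v :
  let u := v * 2 ^ j + (2 ^ j).-1 in champ j (u + per j %/ 2) = ~~ champ j u.
Proof.
set n := 2 ^ j => u; have n_gt0 : 0 < n by rewrite expn_gt0.
have -> : per j %/ 2 = 2 ^ n.-1 * n.
  by rewrite /per -/n -{2}(prednK n_gt0) expnS mulnCA mulKn // mulnC.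
have um : u %% n = n.-1 by rewrite modnMDl modn_small // prednK.
have ud : u %/ n = v by rewrite divnMDl // divn_small ?addn0 // prednK.
rewrite /champ -/n [u + _]addnC modnMDl divnMDl // um ud.
by rewrite addnC divnDr // divnn expn_gt0 oddD addbT.
Qed.

(** The last position of the word containing [a] works, since a word is no longer than half a
    period. So [per j %/ 2] is not a period of any stretch of length [per j]. *)
Lemma champ_half_neq j a : exists2 u, a <= u < a + per j %/ 2 &
  champ j (u + per j %/ 2) <> champ j u.
Proof.
set n := 2 ^ j; have n_gt0 : 0 < n by rewrite expn_gt0.
have nh : n <= per j %/ 2.
  by rewrite leq_divRL // /per -/n leq_mul2l -{1}(expn1 2) leq_exp2l ?n_gt0 ?orbT.
exists (a %/ n * n + n.-1); last by rewrite champ_half -/n; case: (champ _ _).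
have := divn_eq a n; have := ltn_pmod a n_gt0; lia.
Qed.

(** * Windows of the sequence and occurrence counts *)

Definition win i L := [seq sq u | u <- iota i L].

Lemma size_win i L : size (win i L) = L. Proof. by rewrite size_map size_iota. Qed.

Lemma mkseq_win m : mkseq sq m = win 0 m. Proof. by []. Qed.

Lemma drop_win d i L : drop d (win i L) = win (i + d) (L - d).
Proof. by rewrite /win -map_drop drop_iota. Qed.

Lemma take_win d i L : d <= L -> take d (win i L) = win i d.
Proof. by move=> dL; rewrite /win -map_take take_iota (minn_idPl dL). Qed.

Lemma win_rcons i L : win i L.+1 = rcons (win i L) (sq (i + L)).
Proof. by rewrite /win -addn1 iotaD map_cat cats1. Qed.

Lemma eq_win i i' L :
  win i L = win i' L <-> forall s, s < L -> sq (i + s) = sq (i' + s).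
Proof.
elim: L => [|L IH]; first by split.
rewrite !win_rcons; split=> [/rcons_inj[/IH eqw eqL] s|eqs].
  by rewrite ltnS leq_eqVlt => /predU1P[->//|/eqw].
by rewrite (eqs L) //; congr rcons; apply/IH => s /ltnW; apply: eqs.
Qed.

Lemma occ_win (w : seq bool) m :
  occ w (win 0 m) = count (fun i => win i (size w) == w) (iota 0 (m.+1 - size w)).
Proof.
rewrite /occ size_win; case: (leqP (size w) m) => [le|lt].
  rewrite -subSn //; apply: eq_in_count => i; rewrite mem_iota add0n => /andP[_ ilt].
  by rewrite drop_win add0n take_win //; lia.
(* When [w] is longer than the prefix, [occ] still tests position [0], where the comparison fails
   because the prefix is too short. *)
have /eqP-> : m.+1 - size w == 0 by rewrite subn_eq0.
have /eqP-> : m - size w == 0 by rewrite subn_eq0 ltnW.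
rewrite /= drop0 addn0; case: eqP => // /(congr1 size).
by rewrite size_take size_win ltnNge (ltnW lt) /= => E; rewrite E ltnn in lt.
Qed.

Lemma occ_win_ge (w : seq bool) m s : uniq s ->
    (forall i, i \in s -> i + size w <= m /\ win i (size w) = w) ->
  size s <= occ w (win 0 m).
Proof.
move=> us sP; rewrite occ_win -size_filter uniq_leq_size // => i /sP[le eqw].
by rewrite mem_filter eqw eqxx mem_iota /=; lia.
Qed.

Lemma occ_winP (w : seq bool) m : 0 < occ w (win 0 m) ->
  exists i, i + size w <= m /\ win i (size w) = w.
Proof.
rewrite occ_win -has_count => /hasP[i]; rewrite mem_iota => ilt /eqP eqw.
by exists i; split=> //; lia.
Qed.

Lemma occ_le (w : seq bool) x : occ w x <= (size x).+1.
Proof. by rewrite (leq_trans (count_size _ _)) // size_iota ltnS leq_subr. Qed.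

(** * Deterministic contexts *)


Lemma sq_per j a d : per j %| d -> start j <= a -> a + d < start j.+1 ->
  sq (a + d) = sq a.
Proof.
move=> dv le lt; rewrite /sq (@phase_eq j (a + d)); last by lia.
by rewrite (@phase_eq j a) ?champ_perM //; lia.
Qed.

Lemma win_per j a d L : per j %| d -> start j <= a -> a + d + L <= start j.+1 ->
  win (a + d) L = win a L.
Proof.
move=> dv le lt; apply/eq_win => s sL.
by rewrite addnAC (sq_per dv) //; lia.
Qed.

(* If an earlier occurrence of the last [3 * per j] bits straddled the boundary
   between two phases, it would force on [champ j] the period [per i] of an
   earlier phase [i < j]. *)
Lemma next_bit j m q (L := 3 * per j) :
    start j + 4 * per j <= m < start j.+1 -> L <= q < m ->
    win (q - L) L = win (m - L) L ->
  sq q = sq m.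
Proof.
move=> mP qP /eq_win eqw; have p_gt0 := per_gt0 j.
have eqb t : t < L -> sq (q - L + t) = sq (m - L + t) by apply: eqw.
have qj : phase q <= j by apply: phase_le; lia.
(* If [q - per j] is in the phase of [q], then both bits repeat the one [per j] earlier, and these
   two are matched by the equal windows. *)
have [le|lt] := leqP (start (phase q)) (q - per j).
  have eq1 : sq q = sq (q - per j).
    rewrite -{1}(@subnK (per j) q); last by lia.
    by apply: (@sq_per (phase q)) => //; rewrite ?per_dvdW ?subnK ?phase_lt //; lia.
  have eq2 : sq m = sq (m - per j).
    rewrite -{1}(@subnK (per j) m); last by lia.
    by apply: (@sq_per j) => //; rewrite ?subnK //; lia.
  rewrite eq1 eq2; have := @eqb (L - per j).
  have -> : q - L + (L - per j) = q - per j by lia.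
  have -> : m - L + (L - per j) = m - per j by lia.
  by apply; lia.
(* Otherwise the phase of [q] starts after [q - per j]. It is not phase [0], which starts at [0],
   because [3 * per j <= q]. *)
have := phase_start q; case E: (phase q) qj lt => [|i]; first by rewrite /start; lia.
move=> ij lt le; have := startS2 i; have := startS i => _ iS.
have half : per j %/ 2 * 2 = per j.
  by apply: divnK; apply: dvdn_trans (per_dvd ij); apply: dvdn_mull.
have idv : per i %| per j %/ 2 by rewrite dvdn_divRL ?per_dvd // -half dvdn_mull.
(* The last [per j] positions of phase [i] start at [b] and lie in the window before [q]; [a]
   matches [b] in the window before [m]. The copy would give [champ j] the period [per j %/ 2]
   there, against [champ_half_neq]. *)
set b := start i.+1 - per j; set a := m - L + (b - (q - L)).
have [u uP] := champ_half_neq j a; case.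
have sqj t : m - L <= t -> t < m -> sq t = champ j t.
  by move=> ? ?; rewrite /sq (@phase_eq j) //; lia.
have sq_mq t : t < per j -> sq (a + t) = sq (b + t).
  move=> tp; rewrite /a -addnA -eqb; last by lia.
  by congr sq; lia.
rewrite -!sqj; try by lia.
have -> : u = a + (u - a) by lia.
rewrite -addnA !sq_mq ?addnA; try by lia.
by apply: (@sq_per i) => //; lia.
Qed.

(** One period earlier the same context is followed by [sq m]; [next_bit] excludes the other bit. *)
Lemma suffix_det j m (L := 3 * per j) :
    start j + 4 * per j <= m < start j.+1 ->
  deterministic (win 0 m) (win (m - L) L).
Proof.
move=> mP; have p_gt0 := per_gt0 j; set c := win (m - L) L.
have Lm : L <= m by lia.
have f1 : 0 < freq (win 0 m) c (sq m).
  apply: (@occ_win_ge (rcons c (sq m)) m [:: m - L - per j]) => // i.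
  rewrite inE => /eqP->; rewrite size_rcons size_win; split; first by lia.
  rewrite -(@win_per j _ (per j)) // ?subnK; try by lia.
  by rewrite win_rcons; congr rcons; congr sq; lia.
have f0 : freq (win 0 m) c (~~ sq m) = 0.
  apply/eqP; rewrite -leqn0 leqNgt; apply/negP => /occ_winP[i].
  rewrite size_rcons size_win win_rcons => -[le] /rcons_inj[eqc].
  rewrite (@next_bit j m (i + L)) //; [by case: (sq m) | by lia |].
  by rewrite addnK.
rewrite /deterministic /esc; case: (sq m) f1 f0 => /= f1 ->; by rewrite f1.
Qed.

Lemma suffix_stored j m (L := 3 * per j) :
    start j + 4 * per j <= m < start j.+1 ->
  star_stored (win 0 m) (win (m - L) L).
Proof.
move=> mP; have p_gt0 := per_gt0 j; apply/orP; right.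
apply/andP; split; last first.
  have := suffix_det mP; rewrite /deterministic /esc /occ_followed /tot addn_gt0.
  by do 2!case: (0 < _).
rewrite size_win take_win ?leq_pred //.
apply: (@occ_win_ge _ m [:: m - L; m - L - per j]).
  by rewrite /= inE andbT; apply/eqP; lia.
move=> i; rewrite !inE size_win => /orP[] /eqP->; split; try by [| lia].
rewrite -[in RHS](@subnK (per j) (m - L)); last by lia.
by rewrite (@win_per j) //; lia.
Qed.

(** Shifting back by [1], ..., [r] periods stays inside the phase and gives [r] earlier copies. *)
Lemma suffix_freq j m L r :
    L <= 3 * per j -> start j + (3 + r) * per j <= m < start j.+1 ->
  r <= freq (win 0 m) (win (m - L) L) (sq m).
Proof.
move=> LP mP; have p_gt0 := per_gt0 j.
rewrite -[X in X <= _](size_iota 1) -(size_map (fun i => m - L - i * per j)).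
have lt i : i < r.+1 -> i * per j <= r * per j by move=> ?; rewrite leq_mul2r orbC -ltnS; lia.
apply: occ_win_ge.
  rewrite map_inj_in_uniq ?iota_uniq // => i i'.
  rewrite !mem_iota !add1n => /andP[_ /lt ?] /andP[_ /lt ?] E.
  have /eqP : i * per j = i' * per j by lia.
  by rewrite eqn_pmul2r // => /eqP.
move=> i /mapP[d]; rewrite mem_iota add1n => /andP[d1 /lt dr] ->.
have dp : per j <= d * per j by rewrite leq_pmull.
rewrite size_rcons size_win; split; first by lia.
rewrite -(win_per (dvdn_mull d (dvdnn (per j)))) // ?subnK; try by lia.
by rewrite win_rcons; congr rcons; congr sq; lia.
Qed.

(** * Word frequencies *)


Definition digits v t L := [seq odd (v %/ 2 ^ u) | u <- iota t L].

Lemma digitsS e v t L : digits (v * 2 + (e : bool)) t.+1 L = digits v t L.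
Proof.
rewrite /digits -[t.+1]add1n iotaDl -map_comp; apply: eq_map => u /=.
by rewrite add1n expnS divnMA divnMDl // (divn_small (_ : _ < 2)) ?addn0 //; case: e.
Qed.

Lemma digits0 e v L : digits (v * 2 + (e : bool)) 0 L.+1 = e :: digits v 0 L.
Proof.
rewrite -(digitsS e v) /digits [iota 0 _]/= map_cons expn0 divn1; congr cons.
by rewrite oddD oddM andbF; case: e.
Qed.

Lemma sum_expS n (F : nat -> nat) :
  \sum_(0 <= v < 2 ^ n.+1) F v =
  \sum_(0 <= v < 2 ^ n) (F (v * 2 + false) + F (v * 2 + true)).
Proof.
rewrite expnSr big_nat_mul; apply: eq_bigr => v _.
by rewrite mulSn 2?big_ltn ?big_geq /= ?addn0 ?addn1 //; lia.
Qed.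

(** Prescribing [size w] of the [n] binary digits leaves the others free. The induction peels off
    the least significant digit. *)
Lemma sum_digits n t (w : seq bool) : t + size w <= n ->
  \sum_(0 <= v < 2 ^ n) (digits v t (size w) == w) = 2 ^ (n - size w).
Proof.
elim: n t w => [|n IH] [|t] [|b w]; rewrite ?addSn ?add0n ?ltnS => //= le.
- by rewrite subn0 sum_nat_const_nat subn0 muln1.
- by rewrite subn0 sum_nat_const_nat subn0 muln1.
- rewrite sum_expS subSS -(IH 0) //; apply: eq_bigr => v _; rewrite !digits0.
  by rewrite !eqseq_cons; case: b; rewrite ?addn0.
- by rewrite subn0 sum_nat_const_nat subn0 muln1.
- rewrite sum_expS subSn; last by lia.
  rewrite expnS -(IH t (b :: w)) // mul2n -addnn -big_split.
  by apply: eq_bigr => v _; rewrite !digitsS.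
Qed.

Definition champ_win j i L := [seq champ j u | u <- iota i L].

Definition champ_occ j (w : seq bool) := \sum_(0 <= i < per j) (champ_win j i (size w) == w).

Lemma champ_win_digits j v t L : t + L <= 2 ^ j ->
  champ_win j (v * 2 ^ j + t) L = digits v t L.
Proof.
move=> le; rewrite /champ_win iotaDl -map_comp; apply/eq_in_map => u.
rewrite mem_iota /= /champ => uP; have ult : u < 2 ^ j by lia.
by rewrite modnMDl divnMDl ?expn_gt0 // (divn_small ult) addn0 modn_small.
Qed.

(** Split a start as word index [v] and offset [t]. For [t <= n - K] the window stays in one word
    and [sum_digits] counts exactly; the other [K.-1] offsets straddle two words and contribute
    between [0] and [2 ^ n] each. *)
Lemma champ_occ_bounds j (w : seq bool) (n := 2 ^ j) (K := size w) : 0 < K <= n ->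
  (n.+1 - K) * 2 ^ (n - K) <= champ_occ j w
    <= (n.+1 - K) * 2 ^ (n - K) + K.-1 * 2 ^ n.
Proof.
move=> KP; rewrite /champ_occ /per -/n [n * 2 ^ n]mulnC big_nat_mul.
under eq_bigr => v _ do
  rewrite -{1}[v * _]add0n big_addn mulSn addnK.
rewrite exchange_big /= (@big_cat_nat _ _ _ (n.+1 - K)) //= -/n; last by lia.
rewrite (@eq_big_nat _ _ _ 0 _ _ (fun=> 2 ^ (n - K))); last first.
  move=> t tP; rewrite -(@sum_digits n t w); last by rewrite -/K; lia.
  apply: eq_bigr => v _; rewrite [t + _]addnC champ_win_digits //.
  by rewrite -/n -/K; lia.
rewrite sum_nat_const_nat subn0 leq_addr leq_add2l.
apply: (@leq_trans (\sum_(n.+1 - K <= t < n) 2 ^ n)).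
  apply: leq_sum => t _; apply: (@leq_trans (\sum_(0 <= v < 2 ^ n) 1)).
    by apply: leq_sum => v _; apply: leq_b1.
  by rewrite sum_nat_const_nat subn0 muln1.
by rewrite sum_nat_const_nat leq_mul2r; apply/orP; right; lia.
Qed.

(** Relative to the ideal count [per j / 2 ^ K], the straddling offsets cause an error of at most
    [K * 2 ^ K / 2 ^ j], hence at most one twentieth. *)
Lemma champ_occ_even j (w : seq bool) (K := size w) : 0 < K -> 20 * (K * 2 ^ K) <= 2 ^ j ->
  19 * per j <= 20 * 2 ^ K * champ_occ j w <= 21 * per j.
Proof.
move=> K0 le; have K2 : 0 < 2 ^ K by rewrite expn_gt0.
have Kn : K <= 2 ^ j.
  by apply: leq_trans le; rewrite mulnCA leq_pmulr // muln_gt0.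
have KP : 0 < K <= 2 ^ j by rewrite K0.
have := champ_occ_bounds KP; rewrite -/K /per.
have -> : 2 ^ 2 ^ j = 2 ^ K * 2 ^ (2 ^ j - K) by rewrite -expnD subnKC.
move: le Kn; move: (2 ^ j) => n le Kn.
move: (2 ^ (n - K)) (champ_occ j w) (2 ^ K) K2 le => A N B B0 le /andP[h1 h2].
have KB : K <= K * B by rewrite leq_pmulr.
apply/andP; split.
  apply: leq_trans (leq_mul (leqnn (20 * B)) h1).
  have -> : 20 * B * ((n.+1 - K) * A) = 20 * (n.+1 - K) * (B * A) by lia.
  by rewrite mulnA leq_mul2r; apply/orP; right; lia.
apply: (leq_trans (leq_mul (leqnn (20 * B)) h2)).
have -> : 20 * B * ((n.+1 - K) * A + K.-1 * (B * A)) =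
  (20 * (n.+1 - K) + 20 * (K.-1 * B)) * (B * A) by lia.
rewrite [21 * _]mulnA leq_mul2r; apply/orP; right.
have : K.-1 * B <= K * B by rewrite leq_mul2r leq_pred orbT.
lia.
Qed.

Lemma sum_period p (f : nat -> nat) a : (forall i, f (i + p) = f i) ->
  \sum_(a <= i < a + p) f i = \sum_(0 <= i < p) f i.
Proof.
move=> fp; elim: a => [//|a <-].
case: p fp => [|p] fp; first by rewrite !big_geq // addn0.
rewrite [RHS]big_ltn ?addSn ?big_nat_recr /= ?leq_addr //; try by lia.
by rewrite fp addnC addnS.
Qed.

Lemma occ_sum (w : seq bool) m :
  occ w (win 0 m) = \sum_(0 <= i < m.+1 - size w) (win i (size w) == w).
Proof.
rewrite occ_win /index_iota subn0; elim: (iota _ _) => [|i s IH] /=.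
  by rewrite big_nil.
by rewrite big_cons IH.
Qed.

Lemma occ_mono (w : seq bool) m d :
  occ w (win 0 m) <= occ w (win 0 (m + d)) <= occ w (win 0 m) + d.
Proof.
rewrite !occ_sum (@big_cat_nat _ _ _ (m.+1 - size w) _ ((m + d).+1 - _)) //=; last by lia.
rewrite leq_addr leq_add2l /=.
apply: (@leq_trans (\sum_(m.+1 - size w <= i < (m + d).+1 - size w) 1)).
  by apply: leq_sum => i _; apply: leq_b1.
by rewrite sum_nat_const_nat; lia.
Qed.

(** The windows at the last [per j] starting positions all lie in phase [j] and make up one full
    period. *)
Lemma occ_per j (w : seq bool) m :
    0 < size w -> start j + per j + size w <= m.+1 -> m <= start j.+1 ->
  occ w (win 0 m) = occ w (win 0 (m - per j)) + champ_occ j w.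
Proof.
move=> K0 le1 le2; rewrite !occ_sum.
rewrite (@big_cat_nat _ _ _ ((m - per j).+1 - size w) _ (m.+1 - _)) //=; last by lia.
congr addn; have -> : m.+1 - size w = (m - per j).+1 - size w + per j by lia.
rewrite /champ_occ -(@sum_period _ (fun i => champ_win j i (size w) == w) ((m - per j).+1 - size w)).
  apply: eq_big_nat => i iP; congr (nat_of_bool (_ == _)).
  apply/eq_in_map => u; rewrite mem_iota => uP.
  by rewrite /sq (@phase_eq j) //; lia.
move=> i; congr (nat_of_bool (_ == _)).
by rewrite /champ_win addnC iotaDl -map_comp; apply: eq_map => u /=; rewrite addnC champ_per.
Qed.

(** Removing full periods keeps the error unchanged; what remains of the phase is shorter than
    [2 * per j] and adds at most [2 * Q * per j]. *)
Lemma occ_even_in_phase j (w : seq bool) Q E m :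
    19 * per j <= Q * champ_occ j w <= 21 * per j ->
    20 <= Q -> 0 < size w <= per j ->
    19 * start j <= Q * occ w (win 0 (start j)) + E /\
      Q * occ w (win 0 (start j)) <= 21 * start j + E ->
    start j <= m <= start j.+1 ->
  19 * m <= Q * occ w (win 0 m) + (E + 2 * Q * per j) /\
    Q * occ w (win 0 m) <= 21 * m + (E + 2 * Q * per j).
Proof.
move=> /andP[N1 N2] Q20 KP [s1 s2]; have p_gt0 := per_gt0 j.
elim/ltn_ind: m => m IH mP.
have [le|lt] := leqP (start j + per j + size w) m.+1.
  have [|| IH1 IH2] := IH (m - per j); try by lia.
  by rewrite (@occ_per j w m) ?(mulnDr Q (occ _ _)); lia.
have Qp : 20 * per j <= Q * per j by rewrite leq_mul2r Q20 orbT.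
have := occ_mono w (start j) (m - start j); rewrite subnKC; last by lia.
case/andP; rewrite -(leq_pmul2l (_ : 0 < Q)) => [o1|]; last by lia.
rewrite -(leq_pmul2l (_ : 0 < Q)) ?(mulnDr Q (occ _ _)) => [o2|]; last by lia.
have : Q * (m - start j) <= Q * (2 * per j) by rewrite leq_mul2l; lia.
lia.
Qed.

(** In [E], the first term pays for everything before phase [j0]. The errors [2 * Q * per i] of the
    later phases sum to at most [4 * Q * per j], as [per] at least doubles. *)
Lemma occ_even_phase (w : seq bool) j0 j m (K := size w) (Q := 20 * 2 ^ K)
    (E := Q * (start j0).+1 + 4 * Q * per j) :
    0 < K -> 20 * (K * 2 ^ K) <= 2 ^ j0 -> j0 <= j ->
    start j <= m <= start j.+1 ->
  19 * m <= Q * occ w (win 0 m) + E /\ Q * occ w (win 0 m) <= 21 * m + E.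
Proof.
move=> K0 le; have K2 : 0 < 2 ^ K by rewrite expn_gt0.
have Q20 : 20 <= Q by rewrite leq_pmulr.
rewrite {}/E => j0j mP.
have step i E m' : j0 <= i ->
    19 * start i <= Q * occ w (win 0 (start i)) + E /\
      Q * occ w (win 0 (start i)) <= 21 * start i + E ->
    start i <= m' <= start i.+1 ->
  19 * m' <= Q * occ w (win 0 m') + (E + 2 * Q * per i) /\
    Q * occ w (win 0 m') <= 21 * m' + (E + 2 * Q * per i).
  move=> j0i; have le' : 20 * (K * 2 ^ K) <= 2 ^ i.
    by apply: leq_trans le _; rewrite leq_exp2l.
  apply: occ_even_in_phase; [exact: champ_occ_even | exact: Q20 |].
  rewrite K0 /=; apply: leq_trans (_ : 2 ^ i <= _); last first.
    by rewrite leq_pmulr // expn_gt0.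
  by apply: leq_trans le'; rewrite mulnCA leq_pmulr // muln_gt0.
have -> : Q * (start j0).+1 + 4 * Q * per j =
  Q * (start j0).+1 + 2 * Q * per j + 2 * Q * per j by lia.
have base X : 19 * start j0 <= Q * occ w (win 0 (start j0)) + (Q * (start j0).+1 + X) /\
    Q * occ w (win 0 (start j0)) <= 21 * start j0 + (Q * (start j0).+1 + X).
  have := occ_le w (win 0 (start j0)); rewrite size_win -(@leq_pmul2l Q); last by lia.
  have : 20 * (start j0).+1 <= Q * (start j0).+1 by rewrite leq_mul2r Q20 orbT.
  lia.
apply: (step) => //; move: j0j {mP}; elim: j => [|j IHj].
  by rewrite leqn0 => /eqP j00; have := base (2 * Q * per j0); rewrite j00.
rewrite leq_eqVlt => /predU1P[<-|]; first exact: base.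
rewrite ltnS => j0j; have pS := perS j.
have QpS : 2 * Q * (2 * per j) <= 2 * Q * per j.+1 by rewrite leq_mul2l pS orbT.
have := step _ _ _ j0j (IHj j0j) (_ : start j <= start j.+1 <= start j.+1).
by rewrite leqnn andbT ltnW ?startS // => /(_ isT); lia.
Qed.

Lemma occ_even L : exists m0, forall (w : seq bool) m, size w = L.+1 -> m0 <= m ->
  18 * m <= 20 * 2 ^ L.+1 * occ w (win 0 m) <= 22 * m.
Proof.
set K := L.+1; set Q := 20 * 2 ^ K; pose j0 := 20 * (K * 2 ^ K).
(* From this [m] on, [p := per (phase m)] exceeds [A + 4 * Q], so the error [A + 4 * Q * p] is at
   most [p * p <= m]; this widens [19] and [21] to [18] and [22]. *)
set A := Q * (start j0).+1; exists (start (j0 + A + 4 * Q).+1) => w m wK m0m.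
have := @occ_even_phase w j0 (phase m) m; rewrite wK -/K -/Q -/A.
have ge := phase_ge m0m; have := phase_start m; have := phase_lt m.
move=> lt st; have pg := per_gtn (phase m).
case => //; [exact/ltnW/ltn_expl | by lia | by rewrite st ltnW |].
have pm : per (phase m) * per (phase m) <= m.
  apply: leq_trans st; case: (phase m) ge => // j _; rewrite startSE.
  by rewrite mulnn leq_exp2l ?per_gt1.
have ple : (4 * Q + 1) * per (phase m) <= per (phase m) * per (phase m).
  by rewrite leq_mul2r; apply/orP; right; lia.
lia.
Qed.

(** * Coding probabilities *)


Lemma INR_leq m n : m <= n -> (INR m <= INR n)%R.
Proof. by move=> /leP/le_INR. Qed.

Lemma INR_gt0 n : 0 < n -> (0 < INR n)%R.
Proof. by move=> /ltP/lt_0_INR. Qed.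

Lemma Rdiv_le1 a b : (0 < b -> a <= b -> a / b <= 1)%R.
Proof. by move=> b0 ab; apply: (Rmult_le_reg_r b) => //; field_simplify; lra. Qed.

Lemma esc_eq0 x c : (esc x c == 0) = (tot x c == 0).
Proof. by rewrite /esc /tot; case: (freq x c false); case: (freq x c true). Qed.

Lemma freq_le_tot x c b : freq x c b <= tot x c.
Proof. by rewrite /tot; case: b; [apply: leq_addl | apply: leq_addr]. Qed.

Lemma esc_gt0 x c : 0 < tot x c + esc x c -> 0 < esc x c.
Proof. by rewrite !lt0n addn_eq0 -esc_eq0 andbb. Qed.

Lemma tot_esc_le x c : tot x c + esc x c <= (2 * size x).+4.
Proof.
have f b : freq x c b <= (size x).+1 by apply: occ_le.
by move: (f false) (f true); rewrite /tot /esc; do 2!case: (0 < _); lia.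
Qed.

Lemma chainP_gt0 x b l : (0 < chainP x b l)%R.
Proof.
elim: l => [|c l IH] /=; first lra.
case: ltnP => [f0|_].
  by apply: Rdiv_lt_0_compat; apply: INR_gt0; have := freq_le_tot x c b; lia.
case: eqP => [_|/eqP]; first by rewrite Rmult_1_l.
rewrite -lt0n => Te0; apply: Rmult_lt_0_compat => //.
by apply: Rdiv_lt_0_compat; apply: INR_gt0 => //; apply: esc_gt0.
Qed.

Lemma chainP_le1 x b l : (chainP x b l <= 1)%R.
Proof.
elim: l => [|c l IH] /=; first lra.
have p0 := chainP_gt0 x b l; case: ltnP => [f0|_].
  have := freq_le_tot x c b => fT.
  by apply: Rdiv_le1; [apply: INR_gt0 | apply: INR_leq]; lia.
case: eqP => [_|/eqP]; first by rewrite Rmult_1_l.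
rewrite -lt0n => Te0; have := esc_gt0 Te0 => e0.
have : (0 <= INR (esc x c) / INR (tot x c + esc x c) <= 1)%R.
  split; first by apply: Rlt_le; apply: Rdiv_lt_0_compat; apply: INR_gt0.
  by apply: Rdiv_le1; [apply: INR_gt0 | apply: INR_leq]; lia.
nra.
Qed.

(** By [tot_esc_le], a lower bound for any single factor of [chainP]. *)
Definition min_prob (x : seq bool) : R := / INR (2 * size x).+4.

Lemma min_prob_bounds x : (0 < min_prob x <= / 2)%R.
Proof.
split; first by apply: Rinv_0_lt_compat; apply: INR_gt0.
by apply: Rinv_le_contravar; [lra | apply: (@INR_leq 2)].
Qed.

Lemma min_prob_le x c n : 0 < n -> 0 < tot x c + esc x c ->
  (min_prob x <= INR n / INR (tot x c + esc x c))%R.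
Proof.
move=> n0 Te0; have := INR_leq n0; rewrite [INR 1]/= => n1.
have h : (min_prob x <= / INR (tot x c + esc x c))%R.
  by apply: Rinv_le_contravar; [apply: INR_gt0 | apply/INR_leq/tot_esc_le].
have : (0 < / INR (tot x c + esc x c))%R by apply: Rinv_0_lt_compat; apply: INR_gt0.
rewrite /Rdiv; nra.
Qed.

(** A nondeterministic context has seen both bits, and then codes [b] at once, or none, and then its
    escape is free. So only one factor is paid. *)
Lemma chainP_nondet_ge x b l : all (predC (deterministic x)) l ->
  (min_prob x <= chainP x b l)%R.
Proof.
have [m0 m2] := min_prob_bounds x.
elim: l => [|c l IH] /=; first by [].
case/andP=> cN /IH{}IH; case: ltnP => [f0|].
  by apply: min_prob_le => //; have := freq_le_tot x c b; lia.
rewrite leqn0 => f0; rewrite addn_eq0 -esc_eq0 andbb.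
have -> : esc x c == 0.
  by move: cN f0; rewrite /deterministic /esc; clear IH; case: b; do 2!case: (freq _ _ _).
by rewrite Rmult_1_l.
Qed.

(** At most one paid escape, from the head, precedes the single factor of [chainP_nondet_ge]. *)
Lemma chainP_ge x b l : all (predC (deterministic x)) (behead l) ->
  (min_prob x * min_prob x <= chainP x b l)%R.
Proof.
have [m0 m2] := min_prob_bounds x.
case: l => [|c l] /=; first nra.
move=> /(chainP_nondet_ge b) ge; case: ltnP => [f0|].
  have : (min_prob x <= INR (freq x c b) / INR (tot x c + esc x c))%R.
    by apply: min_prob_le => //; have := freq_le_tot x c b; lia.
  nra.
rewrite leqn0 => f0; case: eqP => [_|/eqP]; first nra.
rewrite -lt0n => Te0.
have := min_prob_le (esc_gt0 Te0) Te0; nra.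
Qed.

(** * Steps of [PPMstar] *)

Lemma drop_star_start_has x rel : has (deterministic x) rel ->
  exists l1 c l2, [/\ rel = l1 ++ c :: l2, drop (star_start x rel) rel = c :: l2,
    deterministic x c & all (predC (deterministic x)) l2].
Proof.
rewrite -[rel]revK; move: (rev rel) => r.
rewrite /star_start revK has_rev size_rev => hr.
rewrite -has_find hr; case: (split_find hr) => c s1 s2 dc nd.
exists (rev s2), c, (rev s1); rewrite rev_cat rev_rcons all_rev all_predC; split=> //.
rewrite -cats1 -catA find_cat (negPf nd) /= dc addn0 size_cat /= addnS subSS addKn.
by rewrite drop_size_cat ?size_rev.
Qed.

Lemma drop_star_start_nondet x rel :
  all (predC (deterministic x)) (behead (drop (star_start x rel) rel)).
Proof.
have [/drop_star_start_has[l1 [c [l2 [_ -> _]]]] //|] := boolP (has (deterministic x) rel).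
move=> nd; have := nd; rewrite /star_start -has_rev has_find size_rev => /negPf->.
by move: nd; rewrite drop0 -all_predC; case: rel => //= c l /andP[].
Qed.

Lemma stepP_star_ge x b : (min_prob x * min_prob x <= stepP PPMstar x b)%R.
Proof. exact/chainP_ge/drop_star_start_nondet. Qed.

Lemma relevant_win M m c : c \in relevant M (win 0 m) ->
  exists2 L, L <= m & c = win (m - L) L.
Proof.
case/mapP=> i; rewrite mem_filter mem_iota size_win => /andP[_ im] ->.
by exists (m - i); rewrite ?leq_subr // drop_win add0n subKn //; lia.
Qed.

Lemma pairwise_relevant M x :
  pairwise (fun c c' : seq bool => size c' <= size c) (relevant M x).
Proof.
rewrite /relevant pairwise_map pairwise_filter //.
apply: (@sub_pairwise _ leq) => [i i' ii'|]; first by rewrite /= !size_drop leq_sub2l.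
by rewrite -sorted_pairwise ?iota_sorted //; apply: leq_trans.
Qed.

(** The suffix of length [3 * per j] is a deterministic candidate, so the chosen context is no
    longer than it and has recurred [per j] times by [suffix_freq]. Being deterministic, it has
    [T = f] and [e = 1]. *)
Lemma stepP_star_good m (j := phase m) :
    start j + 3 * per j * per j <= m ->
  exists2 f, per j <= f & stepP PPMstar (win 0 m) (sq m) = (INR f / INR f.+1)%R.
Proof.
have p1 := per_gt1 j; have p2 : 2 * per j <= per j * per j by rewrite leq_mul2r p1 orbT.
move=> mge; have mlt : m < start j.+1 by apply: phase_lt.
set x := win 0 m; set c0 := win (m - 3 * per j) (3 * per j).
have c0_rel : c0 \in relevant PPMstar x.
  apply/mapP; exists (m - 3 * per j); last by rewrite drop_win add0n subKn //; lia.
  rewrite mem_filter mem_iota size_win drop_win add0n subKn; last by lia.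
  by apply/andP; split; [apply: suffix_stored |]; lia.
have c0_det : deterministic x c0 by apply: suffix_det; lia.
have [|l1 [c [l2 [relE dropE c_det l2_nd]]]] :=
  @drop_star_start_has x (relevant PPMstar x); first by apply/hasP; exists c0.
have c_rel : c \in relevant PPMstar x by rewrite relE mem_cat mem_head orbT.
have [L Lm cE] := relevant_win c_rel.
have Lle : L <= 3 * per j.
  have := pairwise_relevant PPMstar x; rewrite relE pairwise_cat /= => /and4P[/allrelP rl _ _ _].
  move: c0_rel; rewrite relE mem_cat inE => /or3P[c0l1|/eqP c0c|c0l2].
  - by have := rl _ _ c0l1 (mem_head _ _); rewrite cE !size_win.
  - by have := congr1 size c0c; rewrite cE !size_win => ->.
  - by have /negP := allP l2_nd _ c0l2.
have fge : per j <= freq x c (sq m).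
  by rewrite cE; apply: (@suffix_freq j) => //; nia.
exists (freq x c (sq m)) => //.
rewrite /stepP dropE /= (leq_trans (ltnW p1) fge).
have f0 := leq_trans (ltnW p1) fge.
suff -> : tot x c + esc x c = (freq x c (sq m)).+1 by [].
move: c_det f0; rewrite /deterministic /tot /esc.
by case: (sq m); case: (freq x c false) (freq x c true) => [|?] [|?] //; rewrite !addn1 ?addn0.
Qed.

(** * Code lengths *)


(** After the last [k] bits, the longest stored context, both bits have been seen and their counts
    differ by a factor of at most [2]; so no escape occurs. *)
Lemma stepP_bounded_le k : exists m0, forall m, m0 <= m ->
  (stepP (PPMk k) (win 0 m) (sq m) <= 2 / 3)%R.
Proof.
have [m0 even] := occ_even k; exists (m0 + k.+1) => m mge.
set x := win 0 m; set c := win (m - k) k; have km : k <= m by lia.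
have freqP b : 18 * m <= 20 * 2 ^ k.+1 * freq x c b <= 22 * m.
  by rewrite /freq; apply: even; [rewrite size_rcons size_win | lia].
have Q0 : 0 < 20 * 2 ^ k.+1 by rewrite muln_gt0 expn_gt0.
have f0 b : 0 < freq x c b.
  by case: (posnP (freq x c b)) (freqP b) => // ->; rewrite muln0; lia.
have f2 b b' : freq x c b <= 2 * freq x c b'.
  rewrite -(leq_pmul2l Q0) mulnCA; have := freqP b; have := freqP b'; lia.
have : exists l, relevant (PPMk k) x = c :: l.
  rewrite /relevant size_win.
  have -> : iota 0 m.+1 = iota 0 (m - k) ++ m - k :: iota (m - k).+1 k.
    by rewrite -[m - k :: _]/(iota (m - k) k.+1) -[X in iota X _]add0n -iotaD; congr iota; lia.
  rewrite filter_cat (_ : [seq _ <- iota 0 _ | _] = [::]) /=; last first.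
    apply/eqP; rewrite -[_ == _]negbK -has_filter -all_predC; apply/allP => i.
    rewrite mem_iota /= /k_stored -size_eq0 size_drop size_win => iP.
    by rewrite negb_or negb_and; apply/andP; split; [|apply/orP; left]; lia.
  have dE : drop (m - k) x = c by rewrite drop_win add0n subKn.
  rewrite dE (_ : k_stored k x c); first by rewrite /= dE; eexists.
  apply/orP; right; rewrite [size c]size_win leqnn.
  exact: leq_trans (f0 true) (freq_le_tot x c true).
case=> l relE; rewrite /stepP relE /= f0 /esc !f0.
apply: (Rmult_le_reg_r (INR (tot x c + (true + true)))); first by apply: INR_gt0; lia.
rewrite /Rdiv Rmult_assoc Rinv_l; last by apply: not_0_INR; lia.
have : 3 * freq x c (sq m) <= 2 * (tot x c + (true + true)).
  by rewrite /tot; have := f2 (sq m) false; have := f2 (sq m) true; case: (sq m); lia.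
move=> /INR_leq; rewrite !mult_INR [INR 3]/= [INR 2]/=; lra.
Qed.

(** * Logarithmic cost of a prefix *)

Lemma probP_mkseqS M S m :
  probP M (mkseq S m.+1) = (probP M (mkseq S m) * stepP M (mkseq S m) (S m))%R.
Proof.
have foldE s a : foldr Rmult a s = (foldr Rmult 1 s * a)%R.
  by elim: s => [|b s /= ->]; rewrite /= ?Rmult_1_l ?Rmult_assoc.
rewrite /probP !size_mkseq -addn1 iotaD map_cat foldr_cat foldE; congr Rmult.
  congr foldr; apply/eq_in_map => i; rewrite mem_iota add0n => /andP[_ im].
  have im' := ltnW im; rewrite !nth_mkseq ?addn1 ?(leqW im) //; congr (stepP M _ _).
  by rewrite /mkseq -!map_take !take_iota (minn_idPl im') (minn_idPl (leqW im')).
rewrite /= Rmult_1_r nth_mkseq ?addn1 //; congr (stepP M _ _).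
by rewrite /mkseq -map_take take_iota (minn_idPl (leqnSn m)).
Qed.

Lemma stepP_gt0 M x b : (0 < stepP M x b)%R.
Proof. exact: chainP_gt0. Qed.

Lemma probP_gt0 M S m : (0 < probP M (mkseq S m))%R.
Proof.
elim: m => [|m IH]; first by rewrite /probP /=; lra.
by rewrite probP_mkseqS; apply: Rmult_lt_0_compat => //; apply: stepP_gt0.
Qed.

(** Ideal code length in nats, before conversion to bits and rounding. *)
Definition cost M S m : R := - ln (probP M (mkseq S m)).

Lemma cost0 M S : cost M S 0 = 0%R.
Proof. by rewrite /cost /probP /= ln_1 Ropp_0. Qed.

Lemma costS M S m :
  cost M S m.+1 = (cost M S m - ln (stepP M (mkseq S m) (S m)))%R.
Proof.
rewrite /cost probP_mkseqS ln_mult; [lra | exact: probP_gt0 | exact: stepP_gt0].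
Qed.

Lemma cost_le M S m : (cost M S m <= cost M S m.+1)%R.
Proof.
rewrite costS; have := ln_le _ _ (stepP_gt0 M (mkseq S m) (S m)) (chainP_le1 _ _ _).
rewrite ln_1; lra.
Qed.

Lemma cost_ge0 M S m : (0 <= cost M S m)%R.
Proof. by elim: m => [|m IH]; [rewrite cost0; lra | have := cost_le M S m; lra]. Qed.

Lemma ln2_gt0 : (0 < ln 2)%R.
Proof. rewrite -ln_1; apply: ln_increasing; lra. Qed.

Lemma codelen_bounds M S m :
  (cost M S m / ln 2 <= codelen M (mkseq S m) <= cost M S m / ln 2 + 1)%R.
Proof.
rewrite /codelen /Rceil /cost opp_IZR.
set r := (- (- (ln _ / ln 2)))%R; have := base_Int_part r.
have -> : (- ln (probP M (mkseq S m)) / ln 2 = - r)%R by rewrite /r; field; apply: Rgt_not_eq; exact: ln2_gt0.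
lra.
Qed.

Lemma rhoinf_bounded k : Rbar_le (Finite (1 / 2)%R) (rhoinf (PPMk k) sq).
Proof.
have [m0 step] := stepP_bounded_le k; have l2 := ln2_gt0.
(* Since [(3 / 2) ^ 2 >= 2], a step of probability at most [2 / 3] costs at least half a bit. *)
have ln32 : (ln 2 / 2 <= - ln (2 / 3))%R.
  have <- : ln (3 / 2) = (- ln (2 / 3))%R by rewrite -ln_Rinv; [congr ln; field | lra].
  have := ln_le 2 (3 / 2 * (3 / 2)); rewrite ln_mult; lra.
have cost_ge m : ((INR m - INR m0) * (ln 2 / 2) <= cost (PPMk k) sq m)%R.
  elim: m => [|m IH].
    by rewrite cost0 [INR 0]/=; have := pos_INR m0; nra.
  rewrite costS S_INR; have [m0m|mm0] := leqP m0 m.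
    have := ln_le _ _ (stepP_gt0 (PPMk k) (win 0 m) (sq m)) (step m m0m).
    by rewrite mkseq_win; lra.
  have := cost_ge0 (PPMk k) sq m.+1; rewrite costS.
  by have := INR_leq mm0; rewrite S_INR; nra.
have lim : is_lim_seq (fun m => 1 / 2 - INR m0 / 2 * / INR m)%R (Finite (1 / 2)).
  have -> : Finite (1 / 2) = Finite (1 / 2 - INR m0 / 2 * 0)%R by congr Finite; ring.
  apply: is_lim_seq_minus'; first exact: is_lim_seq_const.
  apply: is_lim_seq_mult'; first exact: is_lim_seq_const.
  have -> : Finite 0 = Rbar_inv p_infty by [].
  by apply: is_lim_seq_inv => //; apply: is_lim_seq_INR.
rewrite -(is_LimInf_seq_unique _ _ (is_lim_LimInf_seq _ _ lim)).
apply: LimInf_le; exists 1%N => m /leP m1.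
have im : (0 < / INR m)%R by apply/Rinv_0_lt_compat/INR_gt0.
have [ge _] := codelen_bounds (PPMk k) sq m.
apply: (@Rle_trans _ ((INR m - INR m0) / 2 * / INR m)).
  by right; field; apply: not_0_INR; lia.
apply: Rmult_le_compat_r; first lra.
by apply: Rle_trans ge; apply: (proj1 (Rle_div_r _ _ _ l2)); have := cost_ge m; lra.
Qed.

(** * Total cost of [PPMstar] *)

Definition bad i := i < start (phase i) + 3 * per (phase i) * per (phase i).

Lemma count_bad m (p := per (phase m)) : count bad (iota 0 m) <= 4 * (p * p).
Proof.
(* The term [p * p] covers all earlier phases: when a phase of period [p] ends, its total
   [4 * (p * p)] is at most the square of the next period. *)
suff : count bad (iota 0 m) <= p * p + minn (m - start (phase m)) (3 * (p * p)) by lia.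
rewrite {}/p; elim: m => [//|m IH].
rewrite -addn1 iotaD count_cat /= addn0 add0n addn1.
have st := phase_start m; have lt := phase_lt m.
have badE : bad m = (m < start (phase m) + 3 * (per (phase m) * per (phase m))).
  by rewrite /bad mulnA.
case: (leqP (start (phase m).+1) m.+1) => le.
  rewrite (@phase_eq (phase m).+1 m.+1); last by rewrite le /= (leq_trans _ (startS _)).
  have := leq_mul (perS (phase m)) (perS (phase m)).
  by case: ltnP badE => ? ->; lia.
rewrite (@phase_eq (phase m) m.+1); last by rewrite le leqW.
by case: ltnP badE => ? ->; lia.
Qed.

Lemma ln_le_sub1 y : (0 < y -> ln y <= y - 1)%R.
Proof.
move=> y0; rewrite -[(y - 1)%R]ln_exp; apply: ln_le => //.
have := exp_ineq1_le (y - 1); lra.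
Qed.

Lemma stepP_star_good_cost i : ~~ bad i ->
  (- ln (stepP PPMstar (win 0 i) (sq i)) <= / INR (per (phase i)))%R.
Proof.
rewrite /bad -leqNgt => /stepP_star_good[f pf ->].
have p0 := INR_gt0 (per_gt0 (phase i)); have pf' := INR_leq pf.
rewrite -ln_Rinv; last by apply: Rdiv_lt_0_compat; [lra | apply: INR_gt0].
have -> : (/ (INR f / INR f.+1) = 1 + / INR f)%R.
  by rewrite S_INR; field; split; lra.
apply: Rle_trans (_ : / INR f <= _)%R; last by apply: Rinv_le_contravar.
have f0 : (0 < / INR f)%R by apply: Rinv_0_lt_compat; lra.
have := @ln_le_sub1 (1 + / INR f); lra.
Qed.

Lemma stepP_star_cost i :
  (- ln (stepP PPMstar (win 0 i) (sq i)) <=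
    / INR (per (phase i)) + INR (bad i) * (2 * ln (INR (2 * i).+4)))%R.
Proof.
have p0 : (0 < / INR (per (phase i)))%R.
  by apply: Rinv_0_lt_compat; apply: INR_gt0; apply: per_gt0.
case bi: (bad i); last first.
  by have := stepP_star_good_cost (negbT bi); rewrite [INR false]/=; lra.
have [m0 _] := min_prob_bounds (win 0 i).
have := ln_le _ _ (Rmult_lt_0_compat _ _ m0 m0) (stepP_star_ge (win 0 i) (sq i)).
rewrite ln_mult // /min_prob size_win ln_Rinv; last exact: INR_gt0.
by rewrite [INR true]/=; lra.
Qed.

(** [sum_f_R0] includes the upper index, so this covers [n.+1] steps. *)
Definition good_cost n := sum_f_R0 (fun i => / INR (per (phase i)))%R n.

Lemma cost_star_le m :
  (cost PPMstar sq m.+1 <= good_cost m +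
    INR (count bad (iota 0 m.+1)) * (2 * ln (INR (2 * m).+4)))%R.
Proof.
elim: m => [|m IH].
  have := stepP_star_cost 0; rewrite costS cost0 mkseq_win.
  rewrite -[count bad (iota 0 1)]/(bad 0 + 0) addn0.
  by rewrite -[good_cost 0]/(/ INR (per (phase 0)))%R; lra.
have := stepP_star_cost m.+1; rewrite costS mkseq_win.
rewrite -[in iota 0 m.+2]addn1 iotaD count_cat add0n.
rewrite -[count bad (iota m.+1 1)]/(bad m.+1 + 0) addn0 plus_INR.
rewrite /good_cost tech5 -/(good_cost m).
have : (ln (INR (2 * m).+4) <= ln (INR (2 * m.+1).+4))%R.
  by apply: ln_le; [apply: INR_gt0 | apply: INR_leq; lia].
have := pos_INR (count bad (iota 0 m.+1)); nra.
Qed.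

Lemma is_lim_seq_per : is_lim_seq (fun m => / INR (per (phase m)))%R (Finite 0).
Proof.
have -> : Finite 0 = Rbar_inv p_infty by [].
apply: is_lim_seq_inv => //; apply/is_lim_seq_spec => M.
have [J MJ] := nfloor_ex (Rmax M 0) (Rmax_r _ _).
exists (start J.+1) => m /leP/phase_ge Jm.
apply: Rle_lt_trans (Rmax_l M 0) _.
apply: Rlt_le_trans (proj2 MJ) _; rewrite -S_INR; apply: INR_leq.
exact: leq_trans Jm (ltnW (per_gtn _)).
Qed.

(** With [s = sqrt n], there are at most [4 * p ^ 2] bad steps, [ln (4 * n) <= 4 * s], and
    [p ^ 8 <= n] gives [p ^ 3 <= p ^ 4 <= s]. The hypothesis excludes phase [0], which does not
    start at [per 0 ^ 8]. *)
Lemma bad_cost_le n : start 1 <= n ->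
  (INR (count bad (iota 0 n)) * (2 * ln (4 * INR n)) <=
    32 * / INR (per (phase n)) * INR n)%R.
Proof.
move=> n1; set p := per _; have p1 : (1 <= INR p)%R by apply: (@INR_leq 1); apply: per_gt0.
have n0 : (0 < INR n)%R by apply: INR_gt0; apply: leq_trans n1; apply: start_gt0.
have [s0 s2] : (0 < sqrt (INR n) /\ sqrt (INR n) * sqrt (INR n) = INR n)%R.
  by split; [apply: sqrt_lt_R0 | apply: sqrt_sqrt; lra].
set s := sqrt _ in s0 s2.
have lnb : (ln (4 * INR n) <= 4 * s)%R.
  have -> : (4 * INR n = (2 * s) * (2 * s))%R by rewrite -s2; ring.
  by rewrite ln_mult; [have := @ln_le_sub1 (2 * s) | |]; lra.
have q2 : (INR (p * p) * INR (p * p) <= s)%R.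
  have q8 : p * p * (p * p) * (p * p * (p * p)) <= n.
    apply: leq_trans (phase_start n); have := phase_ge n1.
    by rewrite /p {p p1}; case: (phase n) => // j _; rewrite startSE !mulnn -!expnM.
  move/INR_leq: q8; rewrite mult_INR -s2 mult_INR.
  have := pos_INR (p * p); move: (INR (p * p)) => q q0 h.
  case: (Rle_lt_dec (q * q) s) => // lt; nra.
have cb : (INR (count bad (iota 0 n)) <= 4 * INR (p * p))%R.
  by have := INR_leq (count_bad n); rewrite -/p mult_INR [INR 4]/=; lra.
have c0 := pos_INR (count bad (iota 0 n)).
apply: Rle_trans (_ : 4 * INR (p * p) * (2 * (4 * s)) <= _)%R.
  apply: Rle_trans (_ : INR (count bad (iota 0 n)) * (2 * (4 * s)) <= _)%R; last by nra.
  by apply: Rmult_le_compat_l; lra.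
apply: (Rmult_le_reg_r (INR p)); first lra.
have -> : (32 * / INR p * INR n * INR p = 32 * (s * s))%R by rewrite s2; field; lra.
have : (INR (p * p) * INR p <= s)%R.
  by apply: Rle_trans q2; rewrite mult_INR; nra.
nra.
Qed.

Lemma Rsup_star : Rsup PPMstar sq = Finite 0%R.
Proof.
have l2 := ln2_gt0.
pose g m := (/ INR (per (phase m)))%R.
(* The terms pay for good steps, bad steps and rounding; the first is a Cesaro mean of a null
   sequence. *)
pose bound m := ((sum_f_R0 g m.-1 / INR m + 32 * g m) * / ln 2 + / INR m)%R.
have lim : is_lim_seq bound (Finite 0).
  have -> : Finite 0 = Finite ((0 + 32 * 0) * / ln 2 + 0)%R by congr Finite; ring.
  apply: is_lim_seq_plus'; last first.
    have -> : Finite 0 = Rbar_inv p_infty by [].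
    by apply: is_lim_seq_inv => //; apply: is_lim_seq_INR.
  apply: is_lim_seq_mult'; last exact: is_lim_seq_const.
  apply: is_lim_seq_plus'.
    by apply/is_lim_seq_Reals; apply: Cesaro_1; apply/is_lim_seq_Reals; apply: is_lim_seq_per.
  by apply: is_lim_seq_mult'; [apply: is_lim_seq_const | apply: is_lim_seq_per].
apply/is_LimSup_seq_unique/is_lim_LimSup_seq.
apply: is_lim_seq_le_le_loc (is_lim_seq_const 0%R) lim.
exists (start 1) => n /leP n1.
have n_gt0 : 0 < n by apply: leq_trans n1; apply: start_gt0.
have n0 := INR_gt0 n_gt0; have in0 := Rinv_0_lt_compat _ n0.
have il2 := Rinv_0_lt_compat _ l2.
have [ge le] := codelen_bounds PPMstar sq n; have c0 := cost_ge0 PPMstar sq n.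
rewrite /ratio; split.
  apply: Rmult_le_pos; last lra; apply: Rle_trans ge.
  by apply: Rmult_le_pos; lra.
have costb : (cost PPMstar sq n <= sum_f_R0 g n.-1 + 32 * g n * INR n)%R.
  have := cost_star_le n.-1; rewrite prednK // -/(good_cost n.-1).
  have : (ln (INR (2 * n.-1).+4) <= ln (4 * INR n))%R.
    apply: ln_le; first exact: INR_gt0.
    have n4 : (2 * n.-1).+4 <= 4 * n by lia.
    by have := INR_leq n4; rewrite mult_INR [INR 4]/=; lra.
  have := bad_cost_le n1; have := pos_INR (count bad (iota 0 n)).
  rewrite -/(g n) /good_cost -/g; nra.
apply: Rle_trans (_ : (cost PPMstar sq n / ln 2 + 1) * / INR n <= _)%R.
  by apply: Rmult_le_compat_r; lra.
rewrite /bound Rmult_plus_distr_r Rmult_1_l; apply: Rplus_le_compat_r.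
have -> : (sum_f_R0 g n.-1 / INR n + 32 * g n =
  (sum_f_R0 g n.-1 + 32 * g n * INR n) * / INR n)%R by field; lra.
rewrite /Rdiv Rmult_assoc [(/ ln 2 * _)%R]Rmult_comm -Rmult_assoc.
by do 2!(apply: Rmult_le_compat_r; first lra).
Qed.

Theorem theorem3 :
  exists S : nat -> bool,
    Rsup PPMstar S = Finite 0%R /\
    forall k : nat, Rbar_le (Finite (1 / 2)%R) (rhoinf (PPMk k) S).
Proof. by exists sq; split; [exact: Rsup_star | exact: rhoinf_bounded]. Qed.
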